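(* Let the directed hypergraph $\mathsf H$ be the union of (a) a graph $\mathsf G$ with vertex set $\mathsf V$ that is bipartite with respect to the partition $\mathsf V=\widetilde{\mathsf V}_-\cup\widetilde{\mathsf V}_+$ and such that all of its vertices are co-oriented in all of its edges (i.e. the two endpoints of each edge are co-oriented in it); and (b) a hypergraph on $\mathsf V$ consisting of a unique hyperedge $e$ with $e_{\rm sour}=\widetilde{\mathsf V}_-$ and $e_{\rm targ}=\widetilde{\mathsf V}_+$. Then (counting multiplicity) the spectrum of $\mathcal L_{\mathsf H}$ consists of $0$ (with multiplicity $c-1$), of $\#\mathsf V$, and of all non-zero eigenvalues of $\mathcal L_{\mathsf G}$, where $c$ denotes the number of connected components of $\mathsf G$.
   Context: A directed hypergraph $\mathsf H=(\mathsf V,\mathsf E)$ consists of a finite nonempty set $\mathsf V$ (vertices) and a finite multiset $\mathsf E$ of hyperedges $e=(e_{\rm sour},e_{\rm targ})$, where $e_{\rm sour},e_{\rm targ}\subset\mathsf V$ are disjoint (possibly empty) sets. The incidence matrix is the $\mathsf V\times\mathsf E$-matrix $\mathcal I=(\iota_{ve})$ with $\iota_{ve}=+1$ if $v\in e_{\rm targ}$, $-1$ if $v\in e_{\rm sour}$, $0$ otherwise; the Laplacian is $\mathcal L:=\mathcal I\mathcal I^\top$. Two vertices are co-oriented in $e$ if both belong to $e_{\rm sour}$ or both belong to $e_{\rm targ}$. In (a), the graph $\mathsf G$ is regarded as the directed hypergraph each of whose hyperedges consists of exactly two distinct vertices, both in the source set or both in the target set; hence $\mathcal L_{\mathsf G}$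 is the signless Laplacian of $\mathsf G$. Bipartite with respect to $\widetilde{\mathsf V}_-\cup\widetilde{\mathsf V}_+$ means that $\widetilde{\mathsf V}_\pm$ are disjoint and every edge of $\mathsf G$ has one endpoint in each of them. The union of two directed hypergraphs on the same vertex set has as hyperedge multiset the union (with multiplicities added) of the two hyperedge multisets; its incidence matrix is obtained by juxtaposing the columns of the two incidence matrices. *)

(* Defs.v *)
From mathcomp Require Import all_boot all_order all_algebra.

Set Implicit Arguments.
Unset Strict Implicit.
Unset Printing Implicit Defensive.

Import Order.TTheory GRing.Theory Num.Theory.

(* The multiset of hyperedges is an indexed family: distinct indices may carry
   the same pair (source, target).  The vertex set V is not required to be
   nonempty here. *)
Record dhypergraph (V : finType) := DHypergraph {
  hedge : finType;
  sour : hedge -> {set V};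
  targ : hedge -> {set V};
  sour_targ_disjoint : forall e, [disjoint sour e & targ e]
}.

Section Hypergraph.
Variables (V : finType) (H : dhypergraph V).

Definition hverts (e : hedge H) : {set V} := sour e :|: targ e.

Definition co_oriented (e : hedge H) (u v : V) : bool :=
  (u \in sour e) && (v \in sour e) || (u \in targ e) && (v \in targ e).

(* Parallel edges are allowed. *)
Definition is_graph : Prop := forall e : hedge H, #|hverts e| = 2.

Definition all_co_oriented : Prop :=
  forall (e : hedge H) (u v : V),
    u \in hverts e -> v \in hverts e -> co_oriented e u v.

Definition bipartite_wrt (Vm Vp : {set V}) : Prop :=
  [disjoint Vm & Vp] /\
  forall e : hedge H, #|hverts e :&: Vm| = 1 /\ #|hverts e :&: Vp| = 1.

Definition adjacent : rel V :=
  fun u v => [exists e : hedge H, (u \in hverts e) && (v \in hverts e)].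

Definition ncomponents : nat := n_comp adjacent V.

Local Open Scope ring_scope.

Definition incidence (R : pzRingType) : 'M[R]_(#|V|, #|hedge H|) :=
  \matrix_(i, j)
    if enum_val i \in targ (enum_val j) then 1
    else if enum_val i \in sour (enum_val j) then -1
    else 0.

Definition laplacian (R : pzRingType) : 'M[R]_#|V| :=
  incidence R *m (incidence R)^T.

End Hypergraph.

Section Union.
Variables (V : finType) (H1 H2 : dhypergraph V).

Definition hunion_sour (e : hedge H1 + hedge H2) : {set V} :=
  match e with inl e1 => sour e1 | inr e2 => sour e2 end.

Definition hunion_targ (e : hedge H1 + hedge H2) : {set V} :=
  match e with inl e1 => targ e1 | inr e2 => targ e2 end.

Lemma hunion_disjoint e : [disjoint hunion_sour e & hunion_targ e].
Proof. by case: e => e; apply: sour_targ_disjoint. Qed.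

Definition hunion : dhypergraph V := DHypergraph hunion_disjoint.

End Union.

Definition single_hyperedge (V : finType) (S T : {set V})
    (dST : [disjoint S & T]) : dhypergraph V :=
  @DHypergraph V unit (fun=> S) (fun=> T) (fun=> dST).

(* s lists, with algebraic multiplicity and in any order, all the eigenvalues
   of A; in particular this asserts that they all lie in R. *)
Definition is_spectrum (R : comNzRingType) (n : nat) (A : 'M[R]_n)
    (s : seq R) : Prop :=
  char_poly A = (\prod_(x <- s) ('X - x%:P))%R.

(* Main.v *)
Require Import Defs.
From mathcomp Require Import all_boot all_order all_algebra.
From mathcomp Require Import complex.

(** Let [w] be the row vector equal to [1] on [Vp] and to [-1] on [Vm]. The extra
    hyperedge contributes exactly [w^T *m w] to the Laplacian, so that
    [L_H = L_G + w^T *m w] ([laplacian_hunion], [laplacian_single_hyperedge]).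
    Every edge of [G] joins [Vm] to [Vp] and is co-oriented, so its incidence
    column is proportional to the sum of its two endpoints and is orthogonal to
    [w]; hence [w *m L_G = 0] ([side_row_laplacian]). Adding a rank-one matrix
    along an eigenvector moves only the corresponding eigenvalue
    ([char_poly_rank1_update]): one eigenvalue [0] of [L_G] is replaced by
    [w *m w^T = #|V|], that is,
    ['X * char_poly L_H = ('X - #|V|) * char_poly L_G].

    It remains to count how often [0] occurs in the spectrum of [L_G]. Being
    symmetric over a real closed field, [L_G] has all its eigenvalues in that
    field, and its rank is the number of nonzero ones ([symmetric_spectrum]). Its
    kernel consists of the vectors which, after multiplication by the signs of
    [w], are constant along every edge ([mul_laplacian_bipartite_eq0]), hence on
    every connected component; so its dimension is the number of components
    ([rank_kermx_components]). *)

Set Implicit Arguments.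
Unset Strict Implicit.
Unset Printing Implicit Defensive.

Import Order.TTheory GRing.Theory Num.Theory.
Local Open Scope ring_scope.

(** * Characteristic polynomials and spectra *)

(** Brauer's theorem. With [M := 'X - A], both sides compute, up to a block
    triangular factor, the determinant of the bordered matrix with blocks [M],
    [u], [v], [1]: eliminating [v] by column operations leaves [M - u *m v], and
    eliminating it by row operations is possible because [v *m M] is a multiple
    of [v]. *)
Lemma char_poly_rank1_update (R : comNzRingType) n (A : 'M[R]_n) (a : R)
    (u : 'cV_n) (v : 'rV_n) :
  v *m A = a *: v ->
  ('X - a%:P) * char_poly (A + u *m v)
  = ('X - a%:P - ((v *m u) 0 0)%:P) * char_poly A.
Proof.
move=> vA; set b := 'X - a%:P.
pose M := char_poly_mx A.
pose U := map_mx polyC u; pose W := map_mx polyC v.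
have WM : W *m M = b *: W.
  rewrite /M /char_poly_mx mulmxBr mul_mx_scalar -map_mxM vA map_mxZ.
  by rewrite /b scalerBl.
pose B := block_mx M U W 1%:M.
(* Clear the lower left block of [B] by column operations. *)
have detB : \det B = char_poly (A + u *m v).
  transitivity (\det (B *m block_mx 1%:M 0 (- W) 1%:M)).
    by rewrite det_mulmx det_lblock !det1 !mulr1.
  rewrite mulmx_block !mulmx1 !mulmx0 !mul1mx subrr add0r add0r mulmxN.
  rewrite det_ublock det1 mulr1 /char_poly; congr (\det _).
  by rewrite /M /char_poly_mx map_mxD map_mxM opprD addrA.
(* Clear it by row operations, after scaling the last row by [b]. *)
have := erefl (\det (block_mx 1%:M 0 (- W) b%:M *m B)).
rewrite [in LHS]det_mulmx det_lblock det1 mul1r det_scalar1 detB => ->.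
rewrite mulmx_block !mul1mx !mul0mx !addr0 mulNmx WM mul_scalar_mx addNr.
rewrite det_ublock mulrC; congr (_ * _).
by rewrite mulmx1 det_mx11 mulNmx -map_mxM !mxE eqxx mulr1n addrC.
Qed.

Lemma rank_diag_mx (F : fieldType) n (d : 'rV[F]_n) :
  \rank (diag_mx d) = (\sum_(i < n) (d 0%R i != 0%R))%N.
Proof.
elim: n => [|n IHn] in d *; first by rewrite big_ord0 thinmx0 mxrank0.
pose l := @lsubmx _ 1 1 n d; pose r := @rsubmx _ 1 1 n d.
have dE : d = row_mx l r by rewrite (@hsubmxK _ 1 1 n).
have -> : diag_mx d = block_mx (diag_mx l) 0 0 (diag_mx r).
  by rewrite dE; exact: (@diag_mx_row _ n 1).
rewrite (@rank_diag_block_mx _ 1 1 n n) IHn big_ord_recl; congr addn.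
  have -> : diag_mx l = (d 0 ord0)%:M.
    apply/matrixP => i j; rewrite !mxE !ord1 !eqxx; congr (d _ _ *+ _).
    exact: val_inj.
  by rewrite rank_rV -scalemx1 scalemx_eq0 oner_eq0 orbF.
apply: eq_bigr => i _; rewrite mxE; congr (nat_of_bool (d _ _ != 0)).
exact: val_inj.
Qed.

Lemma char_poly_conj (R : comUnitRingType) n (P A : 'M[R]_n) :
  P \in unitmx -> char_poly (invmx P *m A *m P) = char_poly A.
Proof.
move=> Pu; pose q (B : 'M[R]_n) : 'M[{poly R}]_n := map_mx polyC B.
have qVq : q (invmx P) *m q P = 1%:M by rewrite /q -map_mxM mulVmx // map_mx1.
rewrite /char_poly.
have -> : char_poly_mx (invmx P *m A *m P)
          = q (invmx P) *m char_poly_mx A *m q P.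
  rewrite /char_poly_mx !map_mxM -!/(q _) mulmxBr mulmxBl; congr (_ - _).
  by rewrite mul_mx_scalar -scalemxAl qVq scalemx1.
by rewrite !det_mulmx mulrAC -det_mulmx qVq det1 mul1r.
Qed.

(** Regarded over the algebraically closed field [R[i]], the matrix [A] is
    Hermitian, hence unitarily diagonalizable with real diagonal entries; and
    both the characteristic polynomial and the rank are unchanged by the
    embedding of [R] into [R[i]]. *)
Lemma symmetric_spectrum (R : rcfType) n (A : 'M[R]_n) : A^T = A ->
  exists2 s : seq R, is_spectrum A s & \rank A = count (predC1 0) s.
Proof.
move=> symA; pose f := real_complex R; pose B := map_mx f A.
have realB : B \is a mxOver Num.real.
  by apply/mxOverP => i j; rewrite mxE; apply/complex_realP; exists (A i j).
have hermB : B \is hermsymmx.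
  apply: realsym_hermsym realB; apply/is_hermitianmxP.
  by rewrite scale1r map_mx_id // /B map_trmx symA.
have /orthomx_spectralP := hermitian_normalmx hermB.
have /mxOverP := hermitian_spectral_diag_real hermB.
move: (spectral_diag B) (spectral_unit B) => d.
move: (spectralmx B) => P Pu dR BE.
pose r i := complex.Re (d 0 i).
have rE i : f (r i) = d 0 i by apply: RRe_real.
exists [seq r i | i <- enum 'I_n].
  rewrite /is_spectrum big_map big_enum /=.
  apply: (map_poly_inj f); rewrite map_char_poly -/B BE char_poly_conj //.
  rewrite char_poly_trig ?diag_mx_is_trig // rmorph_prod; apply: eq_bigr => i _.
  by rewrite !mxE eqxx mulr1n rmorphB /= map_polyX map_polyC -rE.
rewrite -(mxrank_map f) -/B BE mxrankMfree ?row_free_unit //.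
rewrite eqmxMfull ?row_full_unit ?unitmx_inv // rank_diag_mx.
rewrite count_map -sum1_count big_enum_cond /= [RHS]big_mkcond /=.
by apply: eq_bigr => i _; rewrite -rE fmorph_eq0; case: eqP.
Qed.

(** * Functions constant on connected components *)

Section RankKernel.

Variables (R : fieldType) (V : finType) (e : rel V) (f : V -> R).
Hypotheses (e_sym : connect_sym e) (f_neq0 : forall v, f v != 0).

(** If [f * x] is constant along the edges, then [x] is determined by its values
    at the roots of the components. The row of [P] indexed by a root is the
    indicator of its component divided by [f]; the rows of [P] form a basis of the
    kernel, and right multiplication by [Q] extracts the coordinates of a kernel
    vector in it, namely the values of [f * x] at the roots. *)
Lemma rank_kermx_components k (A : 'M[R]_(#|V|, k)) :
  (forall x : 'rV_#|V|, x *m A = 0 <->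
     forall u v, e u v ->
       f u * x 0 (enum_rank u) = f v * x 0 (enum_rank v)) ->
  \rank (kermx A) = n_comp e V.
Proof.
move=> kerA; pose C := [predI roots e & V].
have kerA_root (x : 'rV_#|V|) : x *m A = 0 -> forall v,
    let r := fingraph.root e v in
    x 0 (enum_rank v) = x 0 (enum_rank r) * f r / f v.
  move/kerA=> xe v r; apply: (canRL (mulfK (f_neq0 v))); rewrite !(mulrC _ (f _)).
  have /connectP[p] := connect_root e v; rewrite -/r; move: r => r.
  elim: p v => [|z p IHp] v /= => [_ -> //|/andP[evz pz] /(IHp z pz) <-].
  exact: xe.
pose P : 'M[R]_(#|C|, #|V|) := \matrix_(i, j)
  ((fingraph.root e (enum_val j) == enum_val i)%:R / f (enum_val j)).
pose Q : 'M[R]_(#|V|, #|C|) := \matrix_(i, j)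
  ((enum_val i == enum_val j)%:R * f (enum_val i)).
have PA : P *m A = 0.
  apply/row_matrixP => i; rewrite row_mul row0; apply/kerA => u v uv.
  rewrite !mxE !enum_rankK !mulrA ![f _ * _]mulrC !mulfK //.
  by rewrite (fingraph.rootP e_sym (connect1 uv)).
have PQ : P *m Q = 1%:M.
  apply/matrixP => i j; rewrite !mxE.
  rewrite (bigD1 (enum_rank (enum_val j))) //= big1 => [|k' nk'].
    rewrite !mxE !enum_rankK eqxx mul1r divfK // addr0.
    have /andP[/eqP -> _] := enum_valP j.
    by rewrite (inj_eq enum_val_inj) eq_sym.
  rewrite [Q _ _]mxE -(inj_eq enum_rank_inj) enum_valK (negPf nk').
  by rewrite mul0r mulr0.
have kerP (x : 'rV_#|V|) : x *m A = 0 -> x = x *m Q *m P.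
  move=> xA; apply/rowP => j; rewrite mxE.
  have rC : fingraph.root e (enum_val j) \in C by rewrite !inE /= roots_root.
  rewrite (bigD1 (enum_rank_in rC (fingraph.root e (enum_val j)))) //=.
  rewrite big1 => [|i ni].
    rewrite addr0 [P _ _]mxE enum_rankK_in // eqxx mxE.
    rewrite (bigD1 (enum_rank (fingraph.root e (enum_val j)))) //=.
    rewrite big1 => [|i ni].
      rewrite addr0 mxE enum_rankK enum_rankK_in // eqxx !mul1r.
      by rewrite -[j in LHS]enum_valK (kerA_root x xA).
    rewrite mxE enum_rankK_in // -(inj_eq enum_rank_inj) enum_valK (negPf ni).
    by rewrite mul0r mulr0.
  rewrite [P _ _]mxE; have [riE|_] := eqVneq (fingraph.root e _) (enum_val i).
    by move: ni; rewrite -(inj_eq enum_val_inj) enum_rankK_in // riE eqxx.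
  by rewrite mul0r mulr0.
have -> : \rank (kermx A) = \rank P.
  apply: eqmx_rank; apply/andP; split; last by apply/sub_kermxP.
  apply/rV_subP => x /sub_kermxP xA; rewrite (kerP x xA); exact: submxMl.
by apply/eqP; apply/row_freeP; exists Q.
Qed.

End RankKernel.

(** * Laplacians of directed hypergraphs *)

Lemma connect_sym_adjacent (V : finType) (H : dhypergraph V) :
  connect_sym (adjacent H).
Proof.
apply: sym_connect_sym => u v.
by apply/existsP/existsP => -[e ?]; exists e; rewrite andbC.
Qed.

Lemma tr_laplacian (R : comPzRingType) (V : finType) (H : dhypergraph V) :
  (laplacian H R)^T = laplacian H R.
Proof. by rewrite trmx_mul trmxK. Qed.

(** If [x *m L = 0] then [x *m L *m x^T], which is the sum of the squares of the
    entries of [x *m incidence], vanishes. *)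
Lemma mul_laplacian_eq0 (R : rcfType) (V : finType) (H : dhypergraph V)
    (x : 'rV[R]_#|V|) :
  x *m laplacian H R = 0 <-> x *m incidence H R = 0.
Proof.
split=> [xL|xI]; last by rewrite mulmxA xI mul0mx.
have : x *m incidence H R *m (x *m incidence H R)^T = 0.
  by rewrite trmx_mul mulmxA -(mulmxA x) xL mul0mx.
move: (x *m incidence H R) => y /matrixP/(_ 0 0); rewrite !mxE => y0.
apply/rowP => j; rewrite mxE; apply/eqP; rewrite -sqrf_eq0; apply/eqP.
apply: (psumr_eq0P (P := xpredT) (F := fun j => y 0 j ^+ 2)) => [i _||//].
  exact: sqr_ge0.
by rewrite -[RHS]y0; apply: eq_bigr => i _; rewrite mxE.
Qed.

(** The entries of the incidence matrix, indexed by vertices and hyperedges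
    instead of their ranks in the enumerations of [V] and [hedge H]. *)
Definition incidence_coef (R : pzRingType) (V : finType) (H : dhypergraph V)
    (e : hedge H) (v : V) : R :=
  if v \in targ e then 1 else if v \in sour e then -1 else 0.

Lemma laplacianE (R : pzRingType) (V : finType) (H : dhypergraph V) i j :
  laplacian H R i j = \sum_(e : hedge H)
    incidence_coef R e (enum_val i) * incidence_coef R e (enum_val j).
Proof.
rewrite mxE [RHS](reindex _ (onW_bij _ (@enum_val_bij _))).
by apply: eq_bigr => k _; rewrite !mxE.
Qed.

Lemma laplacian_hunion (R : pzRingType) (V : finType) (H1 H2 : dhypergraph V) :
  laplacian (hunion H1 H2) R = laplacian H1 R + laplacian H2 R.
Proof.
by apply/matrixP => i j; rewrite [RHS]mxE !laplacianE big_sumType.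
Qed.

Lemma mul_incidence_eq0 (R : pzRingType) (V : finType) (H : dhypergraph V)
    (x : 'rV[R]_#|V|) :
  x *m incidence H R = 0 <-> forall e : hedge H,
    \sum_v x 0 (enum_rank v) * incidence_coef R e v = 0.
Proof.
have xIE e : (x *m incidence H R) 0 (enum_rank e)
             = \sum_v x 0 (enum_rank v) * incidence_coef R e v.
  rewrite mxE [RHS](reindex _ (onW_bij _ (@enum_val_bij _))).
  apply: eq_bigr => k _.
  by rewrite !mxE enum_rankK enum_valK.
split=> [xI e|xI]; first by rewrite -xIE xI mxE.
by apply/rowP => k; rewrite -[k]enum_valK xIE xI mxE.
Qed.

(** * Bipartite graphs with co-oriented edges *)

Section BipartiteGraph.

Variables (R : rcfType) (V : finType) (Vm Vp : {set V}).
Hypotheses (V_union : Vm :|: Vp = [set: V]) (V_disjoint : [disjoint Vm & Vp]).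
Variable G : dhypergraph V.
Hypotheses (G_bip : bipartite_wrt G Vm Vp) (G_co : all_co_oriented G).

Definition side_sign (v : V) : R := if v \in Vp then 1 else -1.

Lemma side_sign_sqr v : side_sign v * side_sign v = 1.
Proof. by rewrite /side_sign; case: ifP; rewrite ?mulrNN mulr1. Qed.

Lemma side_sign_neq0 v : side_sign v != 0.
Proof. by rewrite /side_sign; case: ifP; rewrite ?oppr_eq0 oner_eq0. Qed.

(** The incidence column of an edge is a nonzero multiple of the indicator of its
    two endpoints, because these are co-oriented. *)
Lemma hedge_shape (e : hedge G) : exists u v (eps : R),
  [/\ side_sign u = -1, side_sign v = 1, hverts e = [set u; v], eps != 0 &
      forall z, incidence_coef R e z = eps *+ (z \in hverts e)].
Proof.
have [/eqP/cards1P[u uE] /eqP/cards1P[v vE]] := G_bip.2 e.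
have eE : hverts e = [set u; v].
  by rewrite -uE -vE -setIUr V_union setIT.
have uVm : u \in Vm by move/setP/(_ u): uE; rewrite !inE eqxx => /andP[].
have vVp : v \in Vp by move/setP/(_ v): vE; rewrite !inE eqxx => /andP[].
have ue : u \in hverts e by rewrite eE !inE eqxx.
exists u, v, (incidence_coef R e u); split=> //.
- by rewrite /side_sign (disjointFr V_disjoint uVm).
- by rewrite /side_sign vVp.
- move: ue; rewrite inE /incidence_coef.
  case: ifP => _; first by rewrite oner_eq0.
  by rewrite orbF => ->; rewrite oppr_eq0 oner_eq0.
move=> z; case: (boolP (z \in hverts e)) => [ze|]; last first.
  by rewrite inE negb_or /incidence_coef => /andP[/negPf -> /negPf ->].
rewrite mulr1n /incidence_coef.
have /orP[/andP[zs us]|/andP[zt ut]] := G_co ze ue; last by rewrite zt ut.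
have sNt y := @disjointFr _ _ _ y (sour_targ_disjoint e).
by rewrite zs us (sNt z zs) (sNt u us).
Qed.

Lemma mul_laplacian_bipartite_eq0 (x : 'rV[R]_#|V|) :
  x *m laplacian G R = 0 <-> forall u v, adjacent G u v ->
    side_sign u * x 0 (enum_rank u) = side_sign v * x 0 (enum_rank v).
Proof.
apply: (iff_trans (mul_laplacian_eq0 _ x)).
apply: (iff_trans (mul_incidence_eq0 _ x)).
(* The equation that an edge imposes on [x] reads [x u + x v = 0]; as the signs
   of [u] and [v] are opposite, it says that the signed values agree. *)
have sumE (e : hedge G) u v eps : side_sign u = -1 -> side_sign v = 1 ->
    hverts e = [set u; v] ->
    (forall z, incidence_coef R e z = eps *+ (z \in hverts e)) ->
    \sum_z x 0 (enum_rank z) * incidence_coef R e z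
    = eps * (side_sign v * x 0 (enum_rank v) - side_sign u * x 0 (enum_rank u)).
  move=> su sv eE incE; have uv : u \notin [set v].
    rewrite inE; apply: contra_eq_neq su => ->; rewrite sv.
    by rewrite -subr_eq0 opprK -mulr2n pnatr_eq0.
  transitivity (\sum_(z in hverts e) x 0 (enum_rank z) * eps).
    rewrite [RHS]big_mkcond; apply: eq_bigr => z _; rewrite incE.
    by case: ifP => _; rewrite ?mulr1n ?mulr0n ?mulr0.
  rewrite eE big_setU1 //= big_set1 su sv mul1r mulN1r opprK.
  by rewrite -mulrDl mulrC addrC.
split=> [x0 a b /existsP[e]|xE e].
  have [u [v [eps [su sv eE eps0 incE]]]] := hedge_shape e.
  move: (x0 e); rewrite (sumE e u v eps) // => /eqP.
  rewrite mulf_eq0 (negPf eps0) subr_eq0 /= => /eqP xuv.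
  by rewrite eE !inE => /andP[/orP[]/eqP-> /orP[]/eqP->].
have [u [v [eps [su sv eE eps0 incE]]]] := hedge_shape e.
rewrite (sumE e u v eps) // (xE v u) ?subrr ?mulr0 //.
by apply/existsP; exists e; rewrite eE !inE !eqxx orbT.
Qed.

Lemma rank_laplacian_bipartite :
  \rank (laplacian G R) = (#|V| - ncomponents G)%N.
Proof.
have kerE := rank_kermx_components (connect_sym_adjacent G) side_sign_neq0
  mul_laplacian_bipartite_eq0.
by rewrite /ncomponents -kerE mxrank_ker subKn ?rank_leq_row.
Qed.

Definition side_row : 'rV[R]_#|V| := \row_i side_sign (enum_val i).

Lemma side_row_laplacian : side_row *m laplacian G R = 0.
Proof.
apply/mul_laplacian_bipartite_eq0 => u v _.
by rewrite !mxE !enum_rankK !side_sign_sqr.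
Qed.

Lemma laplacian_single_hyperedge :
  laplacian (single_hyperedge V_disjoint) R = side_row^T *m side_row.
Proof.
have incE (e : hedge (single_hyperedge V_disjoint)) v :
    incidence_coef R e v = side_sign v.
  have: v \in Vm :|: Vp by rewrite V_union.
  rewrite /incidence_coef /side_sign inE /=.
  by case: (v \in Vp) => //; rewrite orbF => ->.
apply/matrixP => i j; rewrite laplacianE [RHS]mxE big_ord1 !mxE.
by rewrite (big_pred1 tt) ?incE // => -[].
Qed.

Lemma side_row_norm : (side_row *m side_row^T) 0 0 = #|V|%:R.
Proof.
rewrite mxE (eq_bigr (fun=> 1)) ?sumr_const ?card_ord // => i _.
by rewrite !mxE side_sign_sqr.
Qed.

End BipartiteGraph.

Theorem lemma3p9 (R : rcfType) (V : finType) (V_nonempty : (0 < #|V|)%N)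
    (Vm Vp : {set V}) (V_union : Vm :|: Vp = [set: V])
    (V_disjoint : [disjoint Vm & Vp])
    (G : dhypergraph V) (G_graph : is_graph G)
    (G_bip : bipartite_wrt G Vm Vp) (G_co : all_co_oriented G) :
  let H := hunion G (single_hyperedge V_disjoint) in
  (exists s : seq R, is_spectrum (laplacian G R) s) /\
  (forall s : seq R, is_spectrum (laplacian G R) s ->
     is_spectrum (laplacian H R)
       (nseq (ncomponents G).-1 0 ++ #|V|%:R :: [seq x <- s | x != 0])).
Proof.
move=> H.
have [s0 s0_spec rank_s0] := symmetric_spectrum (tr_laplacian R G).
split=> [|s s_spec]; first by exists s0.
have eq_s : perm_eq s s0 by apply: prod_XsubC_eq; rewrite -s_spec -s0_spec.
have size_s : size s = #|V|.
  apply: succn_inj; rewrite -(size_char_poly (laplacian G R)) s_spec.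
  by rewrite size_prod_XsubC.
have comp_gt0 : (0 < ncomponents G)%N.
  have [v _] := card_gt0P V_nonempty; apply/card_gt0P.
  exists (fingraph.root (adjacent G) v); rewrite !inE andbT.
  exact/roots_root/connect_sym_adjacent.
have count0 : count (pred1 0) s = ncomponents G.
  have := count_predC (pred1 0) s; rewrite (permP eq_s (predC _)) -rank_s0.
  rewrite (rank_laplacian_bipartite R V_union V_disjoint G_bip G_co) size_s.
  move=> countE.
  by apply: (@addIn (#|V| - ncomponents G)%N); rewrite countE subnKC ?max_card.
rewrite /is_spectrum /H laplacian_hunion laplacian_single_hyperedge //.
have wL : side_row R Vp *m laplacian G R = 0 *: side_row R Vp.
  by rewrite scale0r (side_row_laplacian R V_union V_disjoint G_bip G_co).
have := char_poly_rank1_update (side_row R Vp)^T wL.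
rewrite side_row_norm subr0 => chiE.
(* The factor ['X] restored here stands for the zero eigenvalue of [L_G] that
   [#|V|] replaces. *)
apply: (mulfI (negbT (polyX_eq0 R))); rewrite chiE s_spec.
rewrite big_cat big_cons big_nseq iter_mulr_1 !subr0 big_filter.
rewrite (bigID (pred1 0)) /= (eq_bigr (fun=> 'X)) => [|x /eqP ->]; last first.
  by rewrite subr0.
rewrite big_const_seq iter_mulr_1 count0 polyC_natr !mulrA -exprS prednK //.
by congr (_ * _); rewrite mulrC.
Qed.
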